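(* Let $\Lambda\colon\mathbb{R}\to[0,1]$ be in standard representation and locally right monotone, and assume that $Q_\Lambda^-(F)\in\mathbb{R}$ for all $F\in\mathcal M$. Let $$\mathcal D:=\{x\in\mathbb{R}\mid\text{there exists }y>x\text{ such that }\Lambda\text{ is decreasing on }(x,y)\}.$$ The following are equivalent: (a) $Q_\Lambda^-$ has the CxLS property. (b) For all $x\in\mathbb{R}\setminus\mathcal D$, it holds that $\Lambda(x)\le\Lambda(x+)$.
   Context: $\mathcal M$ is the set of cumulative distribution functions on $\mathbb{R}$. For $F\in\mathcal M$, $Q_\Lambda^-(F):=\inf\{x\in\mathbb{R}\mid F(x)\ge\Lambda(x)\}$, with $\inf\varnothing=\infty$. Let $N_0:=\inf\{x\in\mathbb{R}\mid\Lambda(x)=0\}$; $\Lambda$ is in standard representation if $\Lambda(x)=0$ for all real $x>N_0$. ''Increasing'' and ''decreasing'' are in the weak sense. $\Lambda$ is locally right monotone if for all $x\in\mathbb{R}$ there exists $y>x$ such that $\Lambda|_{(x,y)}$ is monotone; in particular the right limit $\Lambda(x+):=\lim_{y\downarrow x}\Lambda(y)$ exists for all $x\in\mathbb R$. A functional $\rho$ on $\mathcal M$ has the CxLS property if for all $F,G\in\mathcal M$, $c\in\mathbb{R}$ and $\lambda\in(0,1)$: $\rho(F)=\rho(G)=c$ implies $\rho(\lambda F+(1-\lambda)G)=c$. *)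

(* Defs.v *)
From HB Require Import structures.
From mathcomp Require Import all_boot all_order all_algebra.
From mathcomp Require Import all_classical all_reals all_analysis.
Set Implicit Arguments.
Unset Strict Implicit.
Unset Printing Implicit Defensive.
Import Order.TTheory GRing.Theory Num.Theory.
Import numFieldNormedType.Exports.
Local Open Scope classical_set_scope.
Local Open Scope ring_scope.

Notation CDF R := (cumulativeBounded (0 : R%type) (1 : R%type)).

Section mixture.
Variables (R : realType) (l : R).

Definition mixture of 0 < l < 1 := fun (F G : CDF R) (x : R) =>
  l * F x + (1 - l) * G x.

Variables (l01 : 0 < l < 1) (F G : CDF R).

Local Notation H := (mixture l01 F G).

Let mixture_nd : nondecreasing H.
Proof.
move=> x y xy; case/andP: l01 => l0 l1.
rewrite lerD// ler_wpM2l ?subr_ge0 ?(ltW l0) ?(ltW l1)//;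
  exact: cumulative_is_nondecreasing.
Qed.

Let mixture_cvg (A : set_system R) (FA : Filter A) (a b : R) :
  F @ A --> a -> G @ A --> b -> H @ A --> l * a + (1 - l) * b.
Proof. by move=> Fa Gb; apply: cvgD; apply: cvgMl_tmp. Qed.

Let mixture_rc : right_continuous H.
Proof.
by move=> x; apply: mixture_cvg; exact: cumulative_is_right_continuous.
Qed.

HB.instance Definition _ := isCumulative.Build R _ R H mixture_nd mixture_rc.

Let mixture_Ny : H @ -oo --> (0 : R).
Proof.
rewrite [X in _ --> X](_ : 0 = l * 0 + (1 - l) * 0); last by rewrite !mulr0 addr0.
by apply: mixture_cvg; exact: cumulativeNy.
Qed.

Let mixture_y : H @ +oo --> (1 : R).
Proof.
rewrite [X in _ --> X](_ : 1 = l * 1 + (1 - l) * 1); last by rewrite !mulr1 subrKC.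
by apply: mixture_cvg; exact: cumulativey.
Qed.

HB.instance Definition _ :=
  isCumulativeBounded.Build R 0 1 H mixture_Ny mixture_y.

End mixture.

Section lambda_quantile.
Variable R : realType.
Implicit Types L : R -> R.

Definition Q_minus L (F : CDF R) : \bar R :=
  ereal_inf [set x%:E | x in [set x | L x <= F x]].

Definition N0 L : \bar R := ereal_inf [set x%:E | x in [set x | L x = 0]].

Definition standard_representation L :=
  forall x : R, (N0 L < x%:E)%E -> L x = 0.

Definition increasing_on (i : interval R) L := {in i &, nondecreasing_fun L}.

Definition decreasing_on (i : interval R) L := {in i &, nonincreasing_fun L}.

Definition locally_right_monotone L :=
  forall x, exists2 y, x < y &
    increasing_on `]x, y[ L \/ decreasing_on `]x, y[ L.

Definition right_limit L (x : R) : R := lim (L y @[y --> x^'+]).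

Definition right_decreasing_points L : set R :=
  [set x | exists2 y, x < y & decreasing_on `]x, y[ L].

Definition CxLS (rho : CDF R -> \bar R) :=
  forall (F G : CDF R) (c l : R) (l01 : 0 < l < 1),
    rho F = c%:E -> rho G = c%:E -> rho (mixture l01 F G) = c%:E.

(* `lim` is total; this lemma shows that right_limit is a genuine limit for
   the functions L under consideration. *)
Lemma right_limit_cvg L (x : R) : (forall u, 0 <= L u <= 1) ->
  locally_right_monotone L -> L y @[y --> x^'+] --> right_limit L x.
Proof.
move=> L01 /(_ x)[y xy Lm].
have sub z u : z < y -> u \in `]x, z[ -> u \in `]x, y[.
  by rewrite !in_itv/= => zy /andP[-> uz]; exact: lt_trans uz zy.
case: Lm => Lm.
- apply: nondecreasing_at_right_is_cvgr.
  + near=> z => u v uz vz; apply: Lm; apply: sub (uz) || apply: sub (vz);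
      by near: z; exact: nbhs_right_lt.
  + by near=> z; exists 0 => _ [u _ <-]; case/andP: (L01 u).
- apply: nonincreasing_at_right_is_cvgr.
  + near=> z => u v uz vz; apply: Lm; apply: sub (uz) || apply: sub (vz);
      by near: z; exact: nbhs_right_lt.
  + by near=> z; exists 1 => _ [u _ <-]; case/andP: (L01 u).
Unshelve. all: by end_near. Qed.

End lambda_quantile.

(* Main.v *)
(** A mixture of [F] and [G] reaches [L] only where [F] or [G] does, so CxLS
    amounts to mixing not increasing the common value of [Q_minus L].

    Sufficiency: suppose [Q_minus L F = Q_minus L G = c]. If [c] belongs to both
    sets it belongs to that of the mixture.  Otherwise, say, [F c < L c] and
    [F >= L] at points decreasing to [c], whence [L (c+) <= F c < L c], so that
    [L] decreases on some [(c, y)] and [F], [G], hence their mixtures, dominate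
    [L] there.

    Necessity: if [L (x+) < L x] and [L] does not decrease to the right of [x],
    there are [z_n] strictly decreasing to [x] along which [L] strictly
    decreases.  Two staircases lying below [L], one touching it at the
    [z_n] with [n] even, the other at those with [n] odd, both have quantile
    [x], but they never touch [L] simultaneously, so that the quantile of
    their mixture exceeds [x]. *)
From HB Require Import structures.
Require Import Defs.
From mathcomp Require Import all_boot all_order all_algebra.
From mathcomp Require Import all_classical all_reals all_analysis.
From mathcomp Require Import lra.
Import Order.TTheory GRing.Theory Num.Theory.
Import numFieldNormedType.Exports.
Local Open Scope classical_set_scope.
Local Open Scope ring_scope.

(** * Staircases as distribution functions *)

(* [staircase P] is the largest function bounded by [1] that is at most [t] on
   [(-oo, p)] for every [(p, t)] in [P]. *)
Section staircase.
Context {R : realType} (P : set (R * R)).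

(** The disjunct [t = 1] keeps the set nonempty, so that [inf] is a genuine infimum. *)
Definition stair_values (u : R) : set R :=
  [set t | t = 1 \/ exists2 p, P (p, t) & u < p].

Definition staircase (u : R) : R := inf (stair_values u).

Hypothesis P01 : forall p t, P (p, t) -> 0 <= t <= 1.

Lemma stair_values_has_inf u : has_inf (stair_values u).
Proof.
split; first by exists 1; left.
by exists 0 => t [->//|[p /P01/andP[]]].
Qed.

Lemma staircase_le p t u : P (p, t) -> u < p -> staircase u <= t.
Proof.
move=> Pt up; apply: ge_inf; first by case: (stair_values_has_inf u).
by right; exists p.
Qed.

Lemma staircase_ge a u : a <= 1 -> (forall p t, P (p, t) -> u < p -> a <= t) ->
  a <= staircase u.
Proof.
move=> a1 aP; apply: lb_le_inf; first by case: (stair_values_has_inf u).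
by move=> t [->//|[p Pt up]]; exact: aP Pt up.
Qed.

Lemma staircase_le1 u : staircase u <= 1.
Proof. by apply: ge_inf; [case: (stair_values_has_inf u)|left]. Qed.

Lemma staircase_nd : nondecreasing staircase.
Proof.
move=> u v uv; apply: staircase_ge; first exact: staircase_le1.
by move=> p t Pt vp; apply: staircase_le Pt (le_lt_trans uv vp).
Qed.

(** Since [u < p] is strict, a nearly optimal [t] for [u] stays admissible just to the right of
    [u]. *)
Lemma staircase_rc : right_continuous staircase.
Proof.
move=> u; apply/cvgrPdist_lt => e e0.
have [t tu te] := inf_adherent e0 (stair_values_has_inf u).
have tv : \forall v \near u^'+, staircase v <= t.
  case: tu => [->|[p Pt up]]; first by near=> v; exact: staircase_le1.
  near=> v; apply: staircase_le Pt _.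
  by near: v; exact: nbhs_right_lt.
near=> v.
have uv : staircase u <= staircase v.
  by apply: staircase_nd; apply: ltW; near: v; exact: nbhs_right_gt.
rewrite distrC ger0_norm ?subr_ge0// ltrBlDl.
by apply: le_lt_trans te; near: v.
Unshelve. all: by end_near. Qed.

Hypothesis Pbot : exists p, P (p, 0).
Hypothesis Pbnd : exists M, forall p t, P (p, t) -> p <= M.

Lemma staircase_Ny : staircase @ -oo --> (0 : R).
Proof.
case: Pbot => p Pp; apply: cvg_near_cst; near=> u.
apply/eqP; rewrite eq_le (staircase_le _ _ _ Pp)/=; last first.
  by near: u; exact: nbhs_ninfty_lt (num_real _).
by apply: staircase_ge => // q t /P01/andP[].
Unshelve. all: by end_near. Qed.

Lemma staircase_y : staircase @ +oo --> (1 : R).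
Proof.
case: Pbnd => M PM; apply: cvg_near_cst; near=> u.
apply/eqP; rewrite eq_le staircase_le1/=.
apply: staircase_ge => // q t /PM qM uq.
have : M < u by near: u; exact: nbhs_pinfty_gt (num_real _).
by move=> /lt_trans/(_ uq)/lt_le_trans/(_ qM); rewrite ltxx.
Unshelve. all: by end_near. Qed.

HB.instance Definition _ :=
  isCumulative.Build R _ R staircase staircase_nd staircase_rc.
HB.instance Definition _ :=
  isCumulativeBounded.Build R 0 1 staircase staircase_Ny staircase_y.

Lemma staircase_CDF : exists F : CDF R, F =1 staircase.
Proof. by exists (staircase : CDF R). Qed.

End staircase.

Section Q_minus.
Context {R : realType}.
Implicit Types (L : R -> R) (F G : CDF R).

(** * Bounds on quantiles and mixtures *)

Lemma Q_minus_le L F x : L x <= F x -> (Q_minus L F <= x%:E)%E.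
Proof. by move=> LF; apply: ereal_inf_lbound; exists x. Qed.

Lemma Q_minus_ge L F x : (forall u, u < x -> F u < L u) ->
  (x%:E <= Q_minus L F)%E.
Proof.
move=> FL; apply: le_ereal_inf_tmp => _ [u/= LF <-]; rewrite lee_fin leNgt.
by apply/negP => /FL; rewrite ltNge LF.
Qed.

Lemma Q_minus_le_right L F x :
  (forall y, x < y -> exists2 u, u < y & L u <= F u) ->
  (Q_minus L F <= x%:E)%E.
Proof.
move=> h; apply/lee_addgt0Pr => e e0.
have [|u ue LF] := h (x + e); first by rewrite ltrDl.
by apply: le_trans (Q_minus_le _ _ _ LF) _; rewrite -EFinD lee_fin ltW.
Qed.

Lemma lt_Q_minus L F c u : Q_minus L F = c%:E -> u < c -> F u < L u.
Proof.
move=> Fc uc; rewrite ltNge; apply/negP => /Q_minus_le.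
by rewrite Fc lee_fin leNgt uc.
Qed.

(** [F c < L c] prevents the infimum [c] from being attained, so it is approached strictly from the
    right. *)
Lemma Q_minus_right L F c y : Q_minus L F = c%:E -> F c < L c -> c < y ->
  exists2 u, c < u < y & L u <= F u.
Proof.
move=> Fc FL cy.
have : (Q_minus L F < y%:E)%E by rewrite Fc lte_fin.
move=> /ereal_inf_lt[_ [u/= LF <-]]; rewrite lte_fin => uy.
exists u => //; rewrite uy andbT ltNge le_eqVlt; apply/negP => /orP[/eqP uc|].
  by move: FL; rewrite -uc ltNge LF.
by move=> /(lt_Q_minus _ _ _ _ Fc); rewrite ltNge LF.
Qed.

Lemma mixtureC (l : R) (l01 : 0 < l < 1) (l01' : 0 < 1 - l < 1) F G u :
  mixture l01 F G u = mixture l01' G F u.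
Proof. by rewrite /mixture subKr addrC. Qed.

Lemma ge_mixture (l a : R) (l01 : 0 < l < 1) F G u :
  a <= F u -> a <= G u -> a <= mixture l01 F G u.
Proof. by rewrite /mixture => aF aG; case/andP: l01 => l0 l1; nra. Qed.

Lemma lt_mixture (l a : R) (l01 : 0 < l < 1) F G u :
  F u <= a -> G u <= a -> (F u < a) || (G u < a) -> mixture l01 F G u < a.
Proof.
by rewrite /mixture => aF aG /orP[] h; case/andP: l01 => l0 l1; nra.
Qed.

(** * Sufficiency of the right-limit condition *)

(** Otherwise the midpoint [m] separates [F] from [L] just to the right of [c], against
    [Q_minus_right]. *)
Lemma right_limit_le_CDF L F c : (forall u, 0 <= L u <= 1) ->
  locally_right_monotone L -> Q_minus L F = c%:E -> F c < L c ->
  right_limit L c <= F c.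
Proof.
move=> L01 Lm Fc FL; rewrite leNgt; apply/negP => lim_lt.
have Fcv := cumulative_is_right_continuous F c.
have Lcv := right_limit_cvg L01 Lm (x := c).
pose m := (F c + right_limit L c) / 2.
have mF : F c < m by rewrite /m; lra.
have mL : m < right_limit L c by rewrite /m; lra.
have : \forall u \near c^'+, F u < m /\ m < L u.
  near=> u; split; near: u; first exact: (cvgr_lt (F c)).
  exact: (cvgr_gt (right_limit L c)).
rewrite /at_right /= near_withinE => -[e /= e0 he].
have [|u /andP[cu ue] LFu] := Q_minus_right _ _ _ (c + e) Fc FL.
  by rewrite ltrDl.
have [] := he u _ cu.
  by rewrite /ball/= ltr0_norm ?subr_lt0// opprB ltrBlDl.
by move=> /lt_trans/[apply]; rewrite ltNge LFu.
Unshelve. all: by end_near. Qed.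

Lemma right_limit_ge L c y u : (forall u, 0 <= L u <= 1) ->
  locally_right_monotone L -> decreasing_on `]c, y[ L -> u \in `]c, y[ ->
  L u <= right_limit L c.
Proof.
move=> L01 Lm Ld uI.
have Lcv := right_limit_cvg L01 Lm (x := c).
apply: limr_ge; first exact: cvgP Lcv.
move: (uI); rewrite in_itv/= => /andP[cu uy].
near=> v.
have vu : v < u by near: v; exact: nbhs_right_lt.
apply: Ld => //; last exact: ltW.
rewrite in_itv/= (lt_trans vu uy) andbT.
by near: v; exact: nbhs_right_gt.
Unshelve. all: by end_near. Qed.

(** Some [v] in []c, u[] satisfies [L v <= F v]; from [v] to [u], [F] increases and [L]
    decreases. *)
Lemma Q_minus_ge_decreasing L F c y : decreasing_on `]c, y[ L ->
  Q_minus L F = c%:E -> F c < L c -> forall u, u \in `]c, y[ -> L u <= F u.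
Proof.
move=> Ld Fc FL u uI; move: (uI); rewrite in_itv/= => /andP[cu uy].
have [v /andP[cv vu] LFv] := Q_minus_right _ _ _ _ Fc FL cu.
apply: le_trans (cumulative_is_nondecreasing F _ _ (ltW vu)).
apply: le_trans LFv; apply: Ld => //; last exact: ltW.
by rewrite in_itv/= cv (lt_trans vu uy).
Qed.

Lemma mixture_Q_minus_le L F G (c l : R) (l01 : 0 < l < 1) :
  (forall u, 0 <= L u <= 1) -> locally_right_monotone L ->
  (forall x, ~ right_decreasing_points L x -> L x <= right_limit L x) ->
  Q_minus L F = c%:E -> Q_minus L G = c%:E -> F c < L c ->
  (Q_minus L (mixture l01 F G) <= c%:E)%E.
Proof.
move=> L01 Lm Lb Fc Gc FL.
have lim_lt : right_limit L c < L c.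
  exact: le_lt_trans (right_limit_le_CDF _ _ _ L01 Lm Fc FL) FL.
have [[y cy Ld]|/Lb] := pselect (right_decreasing_points L c); last first.
  by rewrite leNgt lim_lt.
have LF := Q_minus_ge_decreasing _ _ _ _ Ld Fc FL.
have LG u : u \in `]c, y[ -> L u <= G u.
  move=> uI; have [GL|LG] := ltP (G c) (L c).
    exact: Q_minus_ge_decreasing Ld Gc GL _ uI.
  (* The chain is [L u <= L(c+) < L c <= G c <= G u]. *)
  apply: le_trans (right_limit_ge _ _ _ _ L01 Lm Ld uI) _.
  apply: le_trans (ltW lim_lt) (le_trans LG _).
  by apply: cumulative_is_nondecreasing; move: uI; rewrite in_itv/= => /andP[/ltW].
apply: Q_minus_le_right => w cw.
have cm : c < Num.min w y by rewrite lt_min cw.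
exists ((c + Num.min w y) / 2).
  by have := ge_min w w y; rewrite lexx => /= h; lra.
have h : (c + Num.min w y) / 2 \in `]c, y[.
  have := ge_min y w y; rewrite lexx orbT => h.
  by rewrite in_itv/=; apply/andP; split; lra.
by apply: ge_mixture; [exact: LF|exact: LG].
Qed.

Lemma right_limit_CxLS L : (forall u, 0 <= L u <= 1) ->
  locally_right_monotone L ->
  (forall x, ~ right_decreasing_points L x -> L x <= right_limit L x) ->
  CxLS (Q_minus L).
Proof.
move=> L01 Lm Lb F G c l l01 Fc Gc; apply/eqP; rewrite eq_le; apply/andP; split.
  have [FL|LF] := ltP (F c) (L c); first exact: mixture_Q_minus_le.
  have [GL|LG] := ltP (G c) (L c).
    (* Exchanging [F] and [G] along with the weights [l] and [1 - l] reduces this to the previous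
       case. *)
    have l01' : 0 < 1 - l < 1 by move/andP: l01 => [l0 l1]; apply/andP; split; lra.
    rewrite (_ : Q_minus L _ = Q_minus L (mixture l01' G F)).
      exact: mixture_Q_minus_le.
    by rewrite /Q_minus; congr (ereal_inf (image _ _)); apply/seteqP;
      split => u /=; rewrite (mixtureC l l01 l01').
  by apply: Q_minus_le; exact: ge_mixture.
apply: Q_minus_ge => u uc.
have FL := lt_Q_minus _ _ _ _ Fc uc; have GL := lt_Q_minus _ _ _ _ Gc uc.
by apply: lt_mixture; rewrite ?FL// ltW.
Qed.

(** * Necessity: a sequence along which [L] strictly decreases *)

(** Monotonicity fails on []x, m[], with [m] the midpoint of [x] and [w]: [L a < L b] for some
    [a <= b] there. As [L b <= L w], [a] is the witness. *)
Lemma not_right_decreasing L x y w : increasing_on `]x, y[ L ->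
  ~ right_decreasing_points L x -> x < w < y ->
  exists w', [/\ x < w', w' < w, w' - x <= (w - x) / 2 & L w' < L w].
Proof.
move=> Li nD /andP[xw wy]; pose m := (x + w) / 2.
have xm : x < m by rewrite /m; lra.
have mw : m < w by rewrite /m; lra.
apply: contrapT => nw; apply: nD; exists m => // a b.
rewrite !in_itv/= => /andP[xa am] /andP[xb bm] ab; rewrite leNgt.
apply/negP => Lab; apply: nw; exists a; split => //.
- exact: lt_trans mw.
- by move: am; rewrite /m; lra.
- apply: lt_le_trans Lab _; apply: Li; rewrite ?in_itv/=.
  + by rewrite xb (lt_trans bm) ?(lt_trans mw).
  + by rewrite xw.
  + exact: ltW (lt_trans bm mw).
Qed.

Lemma strictly_decreasing_seq L x y w : increasing_on `]x, y[ L ->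
  ~ right_decreasing_points L x -> x < w < y ->
  exists z : nat -> R, [/\ z 0%N = w,
    forall n, x < z n, {homo z : m n / (m < n)%N >-> n < m},
    forall n, L (z n.+1) < L (z n) &
    forall v, x < v -> exists n, z n <= v].
Proof.
move=> Li nD xwy.
have /choice[f fP] : forall a, exists b, x < a < y ->
    [/\ x < b, b < a, b - x <= (a - x) / 2 & L b < L a].
  move=> a; have [xay|] := boolP (x < a < y); last by exists a.
  by have [b ?] := not_right_decreasing _ _ _ _ Li nD xay; exists b.
pose z n := iter n f w.
have zI n : x < z n < y.
  elim: n => // n ih; have [-> fz _ _] := fP _ ih.
  by case/andP: ih => _; apply: lt_trans.
have zx n : z n - x <= (w - x) / 2 ^+ n.
  elim: n => [|n ih]; first by rewrite expr0 divr1.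
  have [_ _ h _] := fP _ (zI n); apply: le_trans h _.
  by rewrite exprSr invfM mulrA ler_pM2r.
exists z; split => //.
- by move=> n; case/andP: (zI n).
- apply: homo_ltn => [a b c ba cb|n]; first exact: lt_trans cb ba.
  by have [] := fP _ (zI n).
- by move=> n; have [] := fP _ (zI n).
move=> v xv.
(* [n], and so [2 ^ n], exceeds [(w - x) / (v - x)], which brings the bound of [zx] below
   [v - x]. *)
pose n := (Num.bound ((w - x) / (v - x))).
exists n; rewrite -(lerD2r (- x)); apply: le_trans (zx n) _.
have wx : 0 < w - x by rewrite subr_gt0; case/andP: xwy.
have vx : 0 < v - x by rewrite subr_gt0.
rewrite ler_pdivrMr ?exprn_gt0// mulrC -ler_pdivrMr//.
apply: ltW; apply: lt_trans (archi_boundP _) _; first by rewrite divr_ge0 ?ltW.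
by rewrite -natrX ltr_nat ltn_expl.
Qed.

(* [(x, 0)] kills the staircase left of [x]; on [[z n.+2, z n)] with [n] of
   parity [b] it is constant, equal to the value of [L] at the left end. *)
Definition parity_stairs L (x : R) (z : nat -> R) (b : bool) : set (R * R) :=
  [set pt | pt = (x, 0) \/
    exists2 n, odd n = b & pt = (z n, L (z n.+2))].

(** * Necessity: two interleaved staircases *)

Section parity.
Context (L : R -> R) (x : R) (z : nat -> R).
Hypothesis L01 : forall u, 0 <= L u <= 1.
Hypothesis Lpos : forall u, u < x -> 0 < L u.
Hypothesis xz : forall n, x < z n.
Hypothesis z_decr : {homo z : m n / (m < n)%N >-> n < m}.
Hypothesis Lz : forall n, L (z n.+1) < L (z n).
Hypothesis z_cvg : forall v, x < v -> exists n, z n <= v.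

Let z_le : {homo z : m n / (m <= n)%N >-> n <= m}.
Proof.
by move=> m n; rewrite leq_eqVlt => /predU1P[->//|/z_decr/ltW].
Qed.

Let Lz_le : {homo L \o z : m n / (m <= n)%N >-> n <= m}.
Proof.
apply: homo_leq => [//|a b c ba cb|n]; first exact: le_trans cb ba.
exact: ltW (Lz n).
Qed.

Lemma parity_stairs01 b p t : parity_stairs L x z b (p, t) -> 0 <= t <= 1.
Proof. by move=> [[_ ->]|[n _ [_ ->//]]]; rewrite ?lexx ?ler01. Qed.

Lemma parity_stairs_CDF b :
  exists F : CDF R, F =1 staircase (parity_stairs L x z b).
Proof.
apply: staircase_CDF; first exact: parity_stairs01.
- by exists x; left.
- exists (z 0%N) => p t [[-> _]|[n _ [-> _]]]; first exact: ltW.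
  exact: z_le.
Qed.

Lemma parity_stairs_lt b u : u < x -> staircase (parity_stairs L x z b) u < L u.
Proof.
move=> ux; apply: le_lt_trans (Lpos _ ux).
by apply: staircase_le ux; [exact: parity_stairs01|left].
Qed.

Lemma parity_stairs_le n u : u < z n ->
  staircase (parity_stairs L x z (odd n)) u <= L (z n.+2).
Proof.
move=> uz; apply: staircase_le uz; first exact: parity_stairs01.
by right; exists n.
Qed.

(** A constraint active at [z n] has an index [m < n] of the same parity, so [m.+2 <= n] and its
    bound [L (z m.+2)] is at least [L (z n)]. *)
Lemma parity_stairs_ge n :
  L (z n) <= staircase (parity_stairs L x z (odd n)) (z n).
Proof.
apply: staircase_ge => [||p t]; [exact: parity_stairs01|by case/andP: (L01 (z n))|].
move=> [[-> _]|[m mn [-> ->]]].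
  by move=> /lt_trans/(_ (xz n)); rewrite ltxx.
move=> zmn; have mn' : (m < n)%N.
  by rewrite ltnNge; apply/negP => /z_le; rewrite leNgt zmn.
apply: Lz_le; rewrite ltn_neqAle mn' andbT.
by apply/eqP => E; move: mn; rewrite -E/=; case: odd.
Qed.

Lemma parity_stairs_Q_minus b (F : CDF R) :
  F =1 staircase (parity_stairs L x z b) -> Q_minus L F = x%:E.
Proof.
move=> FE; apply/eqP; rewrite eq_le; apply/andP; split; last first.
  by apply: Q_minus_ge => u ux; rewrite FE parity_stairs_lt.
apply: Q_minus_le_right => y xy; have [n zny] := z_cvg _ xy.
(* The first index of parity [b] beyond [n]; going beyond [n] makes [z m < y] strict. *)
pose m := if odd n.+1 == b then n.+1 else n.+2.
have nm : (n < m)%N by rewrite /m; case: ifP.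
have mb : odd m = b by rewrite /m; case: eqP => //=; case: (odd n); case: (b).
exists (z m); first exact: lt_le_trans (z_decr _ _ nm) zny.
by rewrite FE -mb; exact: parity_stairs_ge.
Qed.

Lemma parity_stairs_between u y : increasing_on `]x, y[ L ->
  z 0%N < y -> x < u -> u < z 1%N -> exists2 n, u < z n.+1 & L (z n.+2) <= L u.
Proof.
move=> Li z0y xu uz1.
(* The least index with [z _ <= u] is at least 2 because [u < z 1]; writing it [n.+2] gives
   [z n.+2 <= u < z n.+1]. *)
have [[|[|n]] zn nmin] := ex_minnP (z_cvg _ xu).
- by move: (lt_trans uz1 (z_decr 0 1 isT)); rewrite ltNge zn.
- by move: uz1; rewrite ltNge zn.
have un : u < z n.+1 by rewrite ltNge; apply/negP => /nmin; rewrite ltnn.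
exists n => //; apply: Li => //; rewrite in_itv/=.
- by rewrite xz (le_lt_trans _ z0y)// z_le.
- by rewrite xu (lt_trans un)// (le_lt_trans _ z0y)// z_le.
Qed.

(** The range stops at [z 1] because from there on the odd staircase equals 1. *)
Lemma parity_stairs_mixture_lt y (l : R) (l01 : 0 < l < 1) F G u :
  increasing_on `]x, y[ L -> z 0%N < y -> L (z 0%N) < L x ->
  F =1 staircase (parity_stairs L x z false) ->
  G =1 staircase (parity_stairs L x z true) ->
  u < z 1%N -> mixture l01 F G u < L u.
Proof.
move=> Li z0y L0x FE GE uz1; have [ux|xu|ux] := ltgtP u x.
- by apply: lt_mixture; rewrite ?FE ?GE ?parity_stairs_lt// ltW// parity_stairs_lt.
- have [n un Ln] := parity_stairs_between _ _ Li z0y xu uz1.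
  (* The staircase with the parity of [n.+1] is at most [L (z n.+3) < L (z n.+2) <= L u], the other
     at most [L (z n.+2) <= L u]; one strict inequality suffices. *)
  have le1 := parity_stairs_le _ _ un.
  have le0 := parity_stairs_le _ _ (lt_trans un (z_decr _ _ (ltnSn n))).
  have {le1} lt1 := lt_le_trans (le_lt_trans le1 (Lz n.+2)) Ln.
  have {le0} le0 := le_trans le0 Ln.
  move: le0 lt1 => /=; case: odd => /= le0 lt1;
    by apply: lt_mixture; rewrite ?FE ?GE ?lt1 ?orbT// ltW.
- have le0 : staircase (parity_stairs L x z false) u < L u.
    apply: le_lt_trans (parity_stairs_le 0 u _) _; first by rewrite ux.
    by rewrite ux; apply: le_lt_trans L0x; exact: Lz_le 0 2 _.
  have le1 : staircase (parity_stairs L x z true) u < L u.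
    apply: le_lt_trans (parity_stairs_le 1 u _) _; first by rewrite ux.
    by rewrite ux; apply: le_lt_trans L0x; exact: Lz_le 0 3 _.
  by apply: lt_mixture; rewrite ?FE ?GE ?le0// ltW.
Qed.

End parity.

(** A zero of [L] at [u < x] would give [N0 L <= u < x], forcing [L x = 0]. *)
Lemma standard_representation_gt0 L x : (forall u, 0 <= L u <= 1) ->
  standard_representation L -> 0 < L x -> forall u, u < x -> 0 < L u.
Proof.
move=> L01 Ls Lx u ux; rewrite lt0r; case/andP: (L01 u) => -> _; rewrite andbT.
apply/eqP => Lu; move: Lx; rewrite Ls ?ltxx//.
apply: (@le_lt_trans _ _ u%:E); last by rewrite lte_fin.
by apply: ereal_inf_lbound; exists u.
Qed.

Lemma CxLS_right_limit L : (forall u, 0 <= L u <= 1) ->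
  standard_representation L -> locally_right_monotone L ->
  CxLS (Q_minus L) ->
  forall x, ~ right_decreasing_points L x -> L x <= right_limit L x.
Proof.
move=> L01 Ls Lm Lc x nD; rewrite leNgt; apply/negP => lim_lt.
have [y xy [Li|Ld]] := Lm x; last by apply: nD; exists y.
have Lcv := right_limit_cvg L01 Lm (x := x).
have [w [xw wy Lw]] : exists w, [/\ x < w, w < y & L w < L x].
  apply: (@filter_ex _ (x^'+)); near=> w; split; near: w.
  - exact: nbhs_right_gt.
  - exact: nbhs_right_lt.
  - exact: (cvgr_lt (right_limit L x)).
have xwy : x < w < y by rewrite xw.
have [z [z0 xz zd Lz zc]] := strictly_decreasing_seq _ _ _ _ Li nD xwy.
have Lx : 0 < L x by apply: le_lt_trans Lw; case/andP: (L01 w).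
have Lpos := standard_representation_gt0 _ _ L01 Ls Lx.
have [F FE] := parity_stairs_CDF _ _ _ L01 xz zd false.
have [G GE] := parity_stairs_CDF _ _ _ L01 xz zd true.
have FQ : Q_minus L F = x%:E by exact: parity_stairs_Q_minus FE.
have GQ : Q_minus L G = x%:E by exact: parity_stairs_Q_minus GE.
(* Any weight strictly between 0 and 1 would do. *)
have l01 : 0 < (2^-1 : R) < 1 by apply/andP; split; lra.
have HQ := Lc _ _ _ _ l01 FQ GQ.
have : ((z 1%N)%:E <= Q_minus L (mixture l01 F G))%E.
  apply: Q_minus_ge => u uz.
  by apply: (parity_stairs_mixture_lt _ _ _ _ _ _ _ _ _ y) => //; rewrite ?z0.
by rewrite HQ lee_fin leNgt xz.
Unshelve. all: by end_near. Qed.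

End Q_minus.

Theorem theorem6p4 (R : realType) (L : R -> R)
    (L01 : forall x, 0 <= L x <= 1)
    (L_std : standard_representation L)
    (L_mon : locally_right_monotone L)
    (Q_fin : forall F : CDF R, Q_minus L F \is a fin_num) :
  CxLS (Q_minus L) <->
  (forall x, ~ right_decreasing_points L x -> L x <= right_limit L x).
Proof.
split; first exact: CxLS_right_limit.
exact: right_limit_CxLS.
Qed.
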